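(* Let $m\ge0$ be an integer and for $0\le s\le m$ let $$P_{m,s}(y)=\frac{\prod_{j=0}^{s}(1-y^{m+1-j})}{(1-y)^{3s}}\sum_{k=0}^{s}\frac{(-1)^{s-k}}{1-y^{m+1-k}}\left[\binom{2m}{k}-\binom{2m}{k-2}\right]\sum_{i=0}^{s-k}\frac{m-k+1}{m-s+1}\binom{m-s+i}{i}\binom{m-k-i}{s-k-i}y^{s-k-i}.$$ Then each $P_{m,s}(y)\in\mathbb{Z}[y]$, and as rational functions in indeterminates $x,y$, $$\sum_{k=0}^{m}(-1)^k\left[\binom{2m}{k}-\binom{2m}{k-2}\right]\frac{(1-x^{m+1-k})(1-x^{m+1-k}y^{m+1-k})x^k}{1-y^{m+1-k}}=\sum_{k=0}^{m}(-1)^kP_{m,k}(y)\frac{(1-x)^{m+1-k}(1-xy)^{m+1-k}(1-y)^{3k}x^k}{\prod_{i=0}^{k}(1-y^{m+1-i})}.$$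
   Context: Binomial coefficients $\binom{a}{b}$ with integers $a,b$ are taken to be $0$ when $b<0$ or when $0\le a<b$. *)

(* Defs.v *)
From HB Require Import structures.
From mathcomp Require Import all_boot all_order all_algebra.
Set Implicit Arguments. Unset Strict Implicit. Unset Printing Implicit Defensive.
Import Order.TTheory GRing.Theory Num.Theory.
Local Open Scope ring_scope.

Definition K : Type := {fraction {poly int}}.
Definition yK : K := tofrac ('X : {poly int}).

Definition binZ (a : nat) (b : int) : int :=
  match b with Posz n => ('C(a, n))%:Z | Negz _ => 0 end.

Definition bcoef (m k : nat) : int := binZ (2 * m) k%:Z - binZ (2 * m) (k%:Z - 2).

Definition Pms (m s : nat) : K :=
  (\prod_(j < s.+1) (1 - yK ^+ (m.+1 - j))) / (1 - yK) ^+ (3 * s) *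
  \sum_(k < s.+1)
     ((-1) ^+ (s - k) / (1 - yK ^+ (m.+1 - k)) * (bcoef m k)%:~R *
      \sum_(i < (s - k).+1)
        ((m - k + 1)%:R / (m - s + 1)%:R * ('C(m - s + i, i))%:R *
         ('C(m - k - i, s - k - i))%:R * yK ^+ (s - k - i))).

(* Main.v *)
(** Put [u = 1/x], [v = x y] and [t = (1-x)(1-xy)/x = u + v - 1 - u v]. Dividing by
    [x^(m+1)], each summand on the left is a multiple of [u^N + v^N - 1 - y^N], which is
    a polynomial in [t] without constant term; its coefficients come from
    [1/((1-uz)(1-vz)) = 1/((1-z)(1-yz) - tz)]. This gives the expansion, with [P_{m,s}]
    an explicit product times the coefficient [A_s] of [t^(m+1-s)].

    For integrality, [A_s] must vanish to order [2s-1] at [y = 1]. At [x = y^b] the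
    quotients by [1 - y^N] become geometric sums, and the antisymmetry of the numbers
    [binom(2m,k) - binom(2m,k-2)] under [k -> 2m+2-k] turns the left side into a sum of
    multiples of [(1-y^j)^(2m) (1-y^(2j))], hence into a multiple of [(1-y)^(2m+1)].
    Since [x t] is then [(1-y)^2] times a polynomial with value [b(b+1)] at 1, having
    this for all [b] forces the order of vanishing of each [A_s]. *)
Require Import Defs.
From HB Require Import structures.
From mathcomp Require Import all_boot all_order all_algebra.
From mathcomp Require Import ring zify.
Import Order.TTheory GRing.Theory Num.Theory.
Local Open Scope ring_scope.

(** * Expansion of [(1 - x^n)(1 - (xy)^n)] in powers of [(1-x)(1-xy)] *)

(* The coefficient of [z^r] in [(1-z)^-(e+1) (1-yz)^-(f+1)]. *)
Definition hsum {R : comNzRingType} (y : R) (e f r : nat) : R :=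
  \sum_(i < r.+1) ('C(e + i, i))%:R * ('C(f + (r - i), r - i))%:R * y ^+ (r - i).

Lemma hsum0 {R : comNzRingType} (y : R) (e f : nat) : hsum y e f 0 = 1.
Proof. by rewrite /hsum big_ord1 !addn0 !bin0 !mul1r expr0. Qed.

Lemma hsumSl {R : comNzRingType} (y : R) (e f r : nat) :
  hsum y e.+1 f r.+1 = hsum y e f r.+1 + hsum y e.+1 f r.
Proof.
rewrite /hsum 2![in LHS]big_ord_recl [in X in _ = X + _]big_ord_recl /=.
rewrite !addn0 !bin0 -addrA; congr (_ + _).
rewrite -(big_ord_recl _ (fun i : 'I_r.+1 => ('C(e.+1 + bump 0 i, bump 0 i))%:R *
   ('C(f + (r.+1 - bump 0 i), r.+1 - bump 0 i))%:R * y ^+ (r.+1 - bump 0 i))).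
rewrite -big_split /=; apply: eq_bigr => i _.
rewrite /bump /= add1n subSS -!mulrDl -natrD; congr (_%:R * _ * _).
by rewrite !addSn !addnS binS.
Qed.

Lemma hsumSr {R : comNzRingType} (y : R) (e f r : nat) :
  hsum y e f.+1 r.+1 = hsum y e f r.+1 + y * hsum y e f.+1 r.
Proof.
rewrite /hsum big_ord_recr [in X in _ = X + _]big_ord_recr /=.
rewrite subnn !addn0 !bin0 mulr_sumr addrAC; congr (_ + _).
rewrite -big_split /=; apply: eq_bigr => i _.
have ler : (i <= r)%N by rewrite -ltnS.
rewrite subSn // exprS -(addSnnS f) [in LHS]addnS binS natrD.
ring.
Qed.

Lemma hsum_rec1 {R : comNzRingType} (y : R) (e : nat) :
  hsum y e.+1 e.+1 1 = hsum y e e 1 + (1 + y).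
Proof. by rewrite hsumSl hsumSr !hsum0; ring. Qed.

(** Multiplying the generating series by [(1-z)(1-yz) = 1 - (1+y)z + y z^2] lowers both exponents by
    one. *)
Lemma hsum_rec {R : comNzRingType} (y : R) (e r : nat) :
  hsum y e.+1 e.+1 r.+2 = hsum y e e r.+2 + (1 + y) * hsum y e.+1 e.+1 r.+1
     - y * hsum y e.+1 e.+1 r.
Proof. by rewrite hsumSl hsumSr hsumSl; ring. Qed.

Lemma hsum00S {R : comNzRingType} (y : R) (r : nat) :
  hsum y 0 0 r.+1 = hsum y 0 0 r + y ^+ r.+1.
Proof.
rewrite /hsum big_ord_recl /= bin0 subn0 !add0n binn !mul1r addrC; congr (_ + _).
by apply: eq_bigr => i _; rewrite !add0n /bump /= add1n subSS !binn.
Qed.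

(* The coefficient of [t^e] in [u^n + v^n] for [n = e + r > 0], where [u v = y] and
   [t = u + v - 1 - y]. *)
Definition lucas_coef {R : comNzRingType} (y : R) (e r : nat) : R :=
  hsum y e e r - if r is r'.+2 then y * hsum y e e r' else 0.

(** This is [x^n] times the complete homogeneous polynomial of degree [n] in [u] and [v], expanded
    in [t]. Both sides obey the same second-order recurrence in [n]. *)
Lemma geom_hsum {R : comNzRingType} (x y : R) (n : nat) :
  \sum_(r < n.+1) hsum y (n - r) (n - r) r * x ^+ r * ((1 - x) * (1 - x * y)) ^+ (n - r)
  = \sum_(j < n.+1) (x ^+ 2 * y) ^+ j.
Proof.
set T := _ * _.
set F := fun n r => hsum y (n - r) (n - r) r * x ^+ r * T ^+ (n - r).
have F0 k : F k 0%N = T ^+ k by rewrite /F subn0 hsum0 expr0 !mul1r.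
have F1 k : F k.+2 1%N = T * F k.+1 1%N + (1 + y) * x * T ^+ k.+1.
  rewrite /F !subn1 /= hsum_rec1 expr1 exprS; ring.
have Frec k r : (r < k)%N -> F k.+2 r.+2 = T * F k.+1 r.+2
    + (1 + y) * x * F k.+1 r.+1 - x ^+ 2 * y * F k r.
  move=> ltrk; rewrite /F !subSS -(subnSK ltrk) hsum_rec.
  by rewrite !exprS; ring.
(* Kept apart from [Frec]: truncated subtraction would make [T * F k.+1 k.+2] a spurious extra
   term. *)
have Fdiag k : F k.+2 k.+2 = (1 + y) * x * F k.+1 k.+1 - x ^+ 2 * y * F k k.
  by rewrite /F !subnn expr0 !hsum00S !exprS; ring.
have geomS k : \sum_(j < k.+1) (x ^+ 2 * y) ^+ j
    = 1 + x ^+ 2 * y * \sum_(j < k) (x ^+ 2 * y) ^+ j.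
  rewrite big_ord_recl expr0 mulr_sumr; congr (_ + _).
  by apply: eq_bigr => i _; rewrite -exprS.
(* Two consecutive cases feed the recurrence, whose coefficient is [T + (1+y)x = 1 + x^2 y]. *)
suff: \sum_(r < n.+1) F n r = \sum_(j < n.+1) (x ^+ 2 * y) ^+ j
  /\ \sum_(r < n.+2) F n.+1 r = \sum_(j < n.+2) (x ^+ 2 * y) ^+ j by case.
elim: n => [|n [IH0 IH1]].
  rewrite !big_ord_recr !big_ord0 /= !F0 /F subnn hsum00S !hsum0 /T.
  by split; ring.
split=> //.
have -> : \sum_(j < n.+3) (x ^+ 2 * y) ^+ j
   = (T + (1 + y) * x) * \sum_(j < n.+2) (x ^+ 2 * y) ^+ j
     - x ^+ 2 * y * \sum_(j < n.+1) (x ^+ 2 * y) ^+ j.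
  by rewrite geomS [in LHS]geomS [in X in _ = _ * X - _]geomS /T; ring.
rewrite -IH0 -IH1 mulrDl.
rewrite 2!big_ord_recl big_ord_recr /= F0 F1 Fdiag.
rewrite (eq_bigr (fun r : 'I_n => T * F n.+1 r.+2
    + (1 + y) * x * F n.+1 r.+1 - x ^+ 2 * y * F n r)); last first.
  by move=> r _; rewrite /bump /= !add1n Frec.
rewrite sumrB big_split /= -!mulr_sumr.
rewrite [X in _ = T * X + _ - _]big_ord_recl [X in _ = T * (_ + X) + _ - _]big_ord_recl.
rewrite [X in _ = _ + _ * X - _]big_ord_recl [X in _ = _ + _ * (_ + X) - _]big_ord_recr.
rewrite [X in _ = _ - _ * X]big_ord_recr /= !F0 /bump /= !add1n exprS.
under [X in _ = T * (_ + (_ + X)) + _ - _]eq_bigr do rewrite /bump /= !add1n.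
under [X in _ = _ + _ * (_ + (X + _)) - _]eq_bigr do rewrite /bump /= !add1n.
ring.
Qed.

(** Differentiating in [t] with [uv = y] fixed gives [n (u^n - v^n)/(u - v)] from [u^n + v^n]. The
    proof is termwise, by absorption of binomials. *)
Lemma mul_lucas_coef {R : comNzRingType} (y : R) (e r : nat) :
  e.+1%:R * lucas_coef y e.+1 r = (e.+1 + r)%:R * hsum y e e r.
Proof.
(* [D i] is ['C(e + i, i - 1)], with value 0 at [i = 0], so that [y * hsum] at [r - 2] runs over the
   same range as [hsum] at [r]. *)
pose D i : nat := if i is i'.+1 then 'C(e.+1 + i', i') else 0%N.
have absorb i : (e.+1 * 'C(e.+1 + i, i) = (e.+1 + i) * 'C(e + i, i))%N.
  by have := mul_bin_down (e.+1 + i) i; rewrite addnK.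
have absorbD i : (e.+1 * D i = i * 'C(e + i, i))%N.
  case: i => [|i]; first by rewrite muln0.
  by have := mul_bin_left (e.+1 + i) i; rewrite addnK /D -addSnnS.
have term i j : (e.+1 * ('C(e.+1 + i, i) * 'C(e.+1 + j, j)) =
    (e.+1 + (i + j)) * ('C(e + i, i) * 'C(e + j, j)) + e.+1 * (D i * D j))%N.
  apply/eqP; rewrite -(eqn_pmul2l (ltn0Sn e)) mulnDr; apply/eqP.
  transitivity ((e.+1 * 'C(e.+1 + i, i)) * (e.+1 * 'C(e.+1 + j, j)))%N; first by ring.
  transitivity (e.+1 * ((e.+1 + (i + j)) * ('C(e + i, i) * 'C(e + j, j)))
    + (e.+1 * D i) * (e.+1 * D j))%N; last by ring.
  by rewrite !absorb !absorbD; ring.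
have -> : lucas_coef y e.+1 r = hsum y e.+1 e.+1 r
    - \sum_(i < r.+1) (D i)%:R * (D (r - i)%N)%:R * y ^+ (r - i).
  rewrite /lucas_coef; congr (_ - _); case: r => [|[|r]].
  - by rewrite big_ord1 mul0r mul0r.
  - by rewrite !big_ord_recl big_ord0 /= !mulr0 !mul0r !addr0.
  rewrite big_ord_recl big_ord_recr /= subnn mul0r !mulr0 !mul0r add0r addr0.
  rewrite mulr_sumr; apply: eq_bigr => i _; rewrite /bump /= add1n.
  have ler : (i <= r)%N by rewrite -ltnS.
  by rewrite subSS subSn // exprS [in RHS]/D; ring.
rewrite mulrBr !mulr_sumr; apply/eqP; rewrite subr_eq; apply/eqP.
rewrite -big_split /=; apply: eq_bigr => i _.
have ler : (i <= r)%N by rewrite -ltnS.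
have : e.+1%:R * ('C(e.+1 + i, i)%:R * 'C(e.+1 + (r - i), r - i)%:R)
    = (e.+1 + r)%:R * ('C(e + i, i)%:R * 'C(e + (r - i), r - i)%:R)
      + e.+1%:R * ((D i)%:R * (D (r - i)%N)%:R) :> R.
  by rewrite -!natrM -natrD term subnKC.
by move=> E; rewrite [LHS]mulrA E; ring.
Qed.

(** For [N = n.+1] the left side is [x^N (u^N + v^N - 1 - y^N)]. The constant term [1 + y^N] of
    [u^N + v^N] cancels, so the index [r = N] is absent. *)
Lemma lucas_expansion {R : comNzRingType} (x y : R) (n : nat) :
  (1 - x ^+ n.+1) * (1 - (x * y) ^+ n.+1) =
  \sum_(r < n.+1) lucas_coef y (n.+1 - r) r * x ^+ r
    * ((1 - x) * (1 - x * y)) ^+ (n.+1 - r).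
Proof.
have c0 : lucas_coef y 0 n.+1 = 1 + y ^+ n.+1.
  have h00 k : hsum y 0 0 k.+1 = 1 + y * hsum y 0 0 k.
    elim: k => [|k IH]; first by rewrite hsum00S !hsum0 mulr1.
    by rewrite hsum00S [in LHS]IH hsum00S [in LHS]exprS; ring.
  rewrite /lucas_coef; case: n => [|n]; first by rewrite hsum00S hsum0 subr0.
  by rewrite hsum00S h00; ring.
(* With [h] complete homogeneous, [u^N + v^N = h_N - uv h_(N-2)]. *)
have E : \sum_(r < n.+2) lucas_coef y (n.+1 - r) r * x ^+ r
    * ((1 - x) * (1 - x * y)) ^+ (n.+1 - r) = 1 + (x ^+ 2 * y) ^+ n.+1.
  rewrite /lucas_coef.
  under eq_bigr do rewrite mulrBl mulrBl.
  rewrite sumrB geom_hsum.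
  have -> : \sum_(r < n.+2) (if val r is r'.+2
      then y * hsum y (n.+1 - r) (n.+1 - r) r' else 0) * x ^+ r
      * ((1 - x) * (1 - x * y)) ^+ (n.+1 - r)
    = x ^+ 2 * y * \sum_(j < n) (x ^+ 2 * y) ^+ j.
    rewrite 2!big_ord_recl /= !mul0r !add0r.
    case: n {c0} => [|n]; first by rewrite !big_ord0 mulr0.
    rewrite -geom_hsum mulr_sumr; apply: eq_bigr => i _.
    by rewrite /bump /= !add1n !subSS !exprS; ring.
  rewrite big_ord_recl expr0; under eq_bigr do rewrite lift0 exprS.
  rewrite -mulr_sumr big_ord_recr /= (exprS _ n); ring.
move: E; rewrite big_ord_recr /= subnn expr0 mulr1 c0 => /(canRL (addrK _)) ->.
by rewrite (exprMn n.+1 (x ^+ 2) y) (exprMn n.+1 x y) exprAC expr2; ring.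
Qed.

(** * The numbers [bcoef] and the left side at [x = y^b] *)

Lemma bcoefE (m k : nat) :
  bcoef m k = 'C(2 * m, k)%:Z - (if k is k'.+2 then 'C(2 * m, k')%:Z else 0).
Proof.
rewrite /bcoef; case: k => [|[|k]] //.
by rewrite (_ : k.+2%:Z - 2 = k%:Z) //; lia.
Qed.

Lemma bcoef_anti (m k : nat) : (k <= m)%N ->
  bcoef m (2 * m + 2 - k) = - bcoef m k.
Proof.
move=> lekm; rewrite !bcoefE.
have -> : (2 * m + 2 - k)%N = (2 * m - k).+2 by lia.
rewrite bin_sub; last by lia.
suff -> : ('C(2 * m, (2 * m - k).+2))%:Z = if k is k'.+2 then 'C(2 * m, k')%:Z else 0.
  by rewrite opprB.
case: k lekm => [|[|k]] lekm; try by rewrite bin_small //; lia.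
by rewrite -(bin_sub (m := k)); [congr ('C(_, _)%:Z); lia | lia].
Qed.

Lemma bcoef_mid (m : nat) : bcoef m m.+1 = 0.
Proof.
rewrite bcoefE; case: m => [|m]; first by [].
rewrite -(bin_sub (m := m)); last by lia.
by rewrite (_ : (2 * m.+1 - m = m.+2)%N) ?subrr //; lia.
Qed.

(** The signed [bcoef m k] are the coefficients of the right side; antisymmetry folds the upper half
    onto the lower. *)
Lemma bcoef_gen {R : comNzRingType} (w : R) (m : nat) :
  \sum_(k < m.+1) (-1) ^+ k * (bcoef m k)%:~R * (w ^+ k - w ^+ (2 * m + 2 - k))
  = (1 - w) ^+ (2 * m) * (1 - w ^+ 2).
Proof.
have full : \sum_(k < (2 * m).+3) (-1) ^+ k * (bcoef m k)%:~R * w ^+ k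
    = (1 - w) ^+ (2 * m) * (1 - w ^+ 2).
  under eq_bigr do rewrite bcoefE rmorphB mulrBr mulrBl /=.
  rewrite sumrB mulrBr mulr1; congr (_ - _).
    rewrite 2!big_ord_recr /= !bin_small ?ltnS ?leqnSn // !mulr0 !mul0r !addr0.
    rewrite exprBn; apply: eq_bigr => i _.
    by rewrite expr1n mulr1 -mulr_natr mulrAC -pmulrn.
  rewrite 2!big_ord_recl /= !mulr0 !mul0r !add0r exprBn mulr_suml.
  apply: eq_bigr => i _; rewrite /bump /= !add1n expr1n mulr1 -mulr_natr !exprS.
  by rewrite -pmulrn; ring.
rewrite -full (_ : (2 * m).+3 = m.+1 + m.+2)%N; last by lia.
rewrite [RHS]big_split_ord [X in _ = _ + X]big_ord_recl /=.
rewrite addn0 bcoef_mid mulr0 mul0r add0r.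
rewrite [X in _ = _ + X](reindex_inj rev_ord_inj) /= -big_split /=.
apply: eq_bigr => i _.
have lei : (i <= m)%N by rewrite -ltnS.
rewrite /bump /= (_ : (m.+1 + (1 + (m.+1 - i.+1)) = 2 * m + 2 - i)%N); last by lia.
rewrite bcoef_anti // mulrBr rmorphN /=.
have -> : (-1) ^+ (2 * m + 2 - i) = (-1) ^+ i :> R.
  by rewrite -signr_odd -[in RHS]signr_odd; congr (_ ^+ nat_of_bool _); lia.
ring.
Qed.

(** With [q = y^N] this removes the denominator [1 - y^N] at [x = y^b]. *)
Lemma quotient_geom {R : comNzRingType} (q : R) (b : nat) :
  (1 - q ^+ b) * (1 - q ^+ b.+1)
  = (1 - q) * \sum_(j < b.+1) (q ^+ (b - j) - q ^+ (b + j)).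
Proof.
rewrite sumrB.
have -> : \sum_(j < b.+1) q ^+ (b + j) = q ^+ b * \sum_(j < b.+1) q ^+ j.
  by rewrite mulr_sumr; apply: eq_bigr => j _; rewrite exprD.
have -> : \sum_(j < b.+1) q ^+ (b - j) = \sum_(j < b.+1) q ^+ j.
  rewrite [RHS](reindex_inj rev_ord_inj) /=.
  by apply: eq_bigr => j _; rewrite subSS.
by rewrite -(opprB (q ^+ b.+1)) subrX1 -mulNr opprB; ring.
Qed.

Lemma bcoef_sum_pow {F : fieldType} (y : F) (m b : nat) :
  (forall n, 1 - y ^+ n.+1 != 0) ->
  \sum_(k < m.+1) (-1) ^+ k * (bcoef m k)%:~R / (1 - y ^+ (m.+1 - k))
     * (1 - (y ^+ b) ^+ (m.+1 - k)) * (1 - (y ^+ b * y) ^+ (m.+1 - k)) * (y ^+ b) ^+ k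
  = \sum_(j < b.+1) y ^+ ((b - j) * m.+1)
      * ((1 - y ^+ j) ^+ (2 * m) * (1 - (y ^+ j) ^+ 2)).
Proof.
move=> y1.
under [RHS]eq_bigr do rewrite -bcoef_gen mulr_sumr.
rewrite exchange_big /=; apply: eq_bigr => k _.
have lek : (k <= m)%N by rewrite -ltnS.
rewrite -exprSr (exprAC y b (m.+1 - k)) (exprAC y b.+1 (m.+1 - k)).
rewrite -(mulrA (_ / _)) quotient_geom mulrA mulfVK; last by rewrite subSn.
rewrite mulr_sumr mulr_suml; apply: eq_bigr => j _.
have lej : (j <= b)%N by rewrite -ltnS.
rewrite [RHS]mulrCA -!mulrA; congr (_ * (_ * _)).
rewrite mulrBl mulrBr -!exprM -!exprD.
(* For [N = m+1-k]: [(b-j)N + bk = (b-j)(m+1) + jk] and [(b+j)N + bk = (b-j)(m+1) + j(2m+2-k)]. *)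
by congr (y ^+ _ - y ^+ _); nia.
Qed.

(** * Expansion of the whole left side *)

(* The coefficient [A_s] of [t^(m+1-s)], up to the sign [(-1)^s]. *)
Definition tcoef {F : fieldType} (y : F) (m s : nat) : F :=
  \sum_(k < s.+1) (-1) ^+ (s - k) / (1 - y ^+ (m.+1 - k)) * (bcoef m k)%:~R
    * lucas_coef y (m.+1 - s) (s - k).

(** Identifies the inner sum of [Pms], by dividing [mul_lucas_coef] by [m - s + 1]. *)
Lemma lucas_coefE {F : fieldType} (y : F) (m s k : nat) :
  (m - s).+1%:R != 0 :> F -> (s <= m)%N -> (k <= s)%N ->
  \sum_(i < (s - k).+1)
        ((m - k + 1)%:R / (m - s + 1)%:R * ('C(m - s + i, i))%:R *
         ('C(m - k - i, s - k - i))%:R * y ^+ (s - k - i))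
  = lucas_coef y (m.+1 - s) (s - k).
Proof.
move=> d_neq0 lesm leks.
rewrite subSn //; apply: (mulfI d_neq0).
rewrite mul_lucas_coef /hsum !mulr_sumr; apply: eq_bigr => i _.
have lei : (i <= s - k)%N by rewrite -ltnS.
rewrite (_ : (m - k - i = m - s + (s - k - i))%N); last by lia.
rewrite (_ : (m - k + 1 = (m - s).+1 + (s - k))%N); last by lia.
by rewrite addn1 !mulrA (mulrAC _ _ _^-1) divff // mul1r.
Qed.

Lemma sum_triangle {R : nzRingType} (G : nat -> nat -> R) (n : nat) :
  \sum_(k < n) \sum_(r < n - k) G k r
  = \sum_(s < n) \sum_(k < s.+1) G k (s - k)%N.
Proof.
transitivity (\sum_(k < n) \sum_(s < n | (k <= s)%N) G k (s - k)%N).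
  apply: eq_bigr => k _.
  rewrite -(big_mkord (fun s => (k <= s)%N) (fun s => G k (s - k)%N)).
  rewrite -(big_nat_widenl (val k) 0 n xpredT) // -{1}(add0n (val k)) big_addn big_mkord.
  by apply: eq_bigr => r _; rewrite addnK.
rewrite (exchange_big_dep xpredT) //=; apply: eq_bigr => s _.
by rewrite (big_ord_widen n (fun k => G k (s - k)%N)).
Qed.

Lemma rmorph_lucas_coef {R S : comNzRingType} (f : {rmorphism R -> S})
    (y : R) (e r : nat) : f (lucas_coef y e r) = lucas_coef (f y) e r.
Proof.
have rmorph_hsum r' : f (hsum y e e r') = hsum (f y) e e r'.
  rewrite /hsum rmorph_sum; apply: eq_bigr => i _.
  by rewrite !rmorphM !rmorph_nat rmorphXn.
rewrite /lucas_coef rmorphB rmorph_hsum; congr (_ - _).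
by case: r => [|[|r]]; rewrite ?rmorph0 // rmorphM rmorph_hsum.
Qed.

(** Each summand is expanded by [lucas_expansion], then terms are regrouped by [s = k + r]. *)
Lemma tcoef_expansion {F : fieldType} (y : F) (m : nat) :
  \sum_(k < m.+1)
     ((((-1) ^+ k * (bcoef m k)%:~R) / (1 - y ^+ (m.+1 - k)))%:P *
      (1 - 'X ^+ (m.+1 - k)) * (1 - ('X * y%:P) ^+ (m.+1 - k)) * 'X ^+ k)
  = \sum_(s < m.+1) (((-1) ^+ s * tcoef y m s)%:P *
      (1 - 'X) ^+ (m.+1 - s) * (1 - 'X * y%:P) ^+ (m.+1 - s) * 'X ^+ s).
Proof.
pose G k r : {poly F} := ((-1) ^+ k * (bcoef m k)%:~R / (1 - y ^+ (m.+1 - k)))%:P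
  * (lucas_coef y (m.+1 - k - r) r)%:P * 'X^(k + r)
  * ((1 - 'X) * (1 - 'X * y%:P)) ^+ (m.+1 - k - r).
transitivity (\sum_(k < m.+1) \sum_(r < m.+1 - k) G k r).
  apply: eq_bigr => k _.
  have lek : (k <= m)%N by rewrite -ltnS.
  rewrite -(mulrA _%:P) /G subSn // lucas_expansion mulr_sumr mulr_suml.
  by apply: eq_bigr => r _; rewrite rmorph_lucas_coef exprD; ring.
rewrite sum_triangle; apply: eq_bigr => s _.
rewrite /tcoef mulr_sumr rmorph_sum !mulr_suml; apply: eq_bigr => k _.
have leks : (k <= s)%N by rewrite -ltnS.
rewrite /G subnKC // -subnDA subnKC // exprMn.
have -> : (-1) ^+ s * ((-1) ^+ (s - k) / (1 - y ^+ (m.+1 - k)) * (bcoef m k)%:~R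
    * lucas_coef y (m.+1 - s) (s - k)) = (-1) ^+ k * (bcoef m k)%:~R
    / (1 - y ^+ (m.+1 - k)) * lucas_coef y (m.+1 - s) (s - k).
  rewrite -[in (-1) ^+ s](subnKC leks) exprD !mulrA -(mulrA ((-1) ^+ k)) -expr2.
  by rewrite sqrr_sign mulr1; ring.
rewrite -polyCM; ring.
Qed.

Lemma tcoef_eval {F : fieldType} (y : F) (m b : nat) :
  (forall n, 1 - y ^+ n.+1 != 0) ->
  \sum_(s < m.+1) (-1) ^+ s * tcoef y m s *
      ((1 - y ^+ b) * (1 - y ^+ b.+1)) ^+ (m.+1 - s) * (y ^+ b) ^+ s
  = \sum_(j < b.+1) y ^+ ((b - j) * m.+1)
      * ((1 - y ^+ j) ^+ (2 * m) * (1 - (y ^+ j) ^+ 2)).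
Proof.
move=> y1; rewrite -bcoef_sum_pow //.
have := congr1 (horner^~ (y ^+ b)) (tcoef_expansion y m).
rewrite !horner_sum => /esym; congr (_ = _); apply: eq_bigr => k _.
  by rewrite !hornerE exprMn mulrA -exprSr.
by rewrite !hornerE.
Qed.

(** * Orders of vanishing at 1 in [{poly int}] *)

Lemma root1_factor (p : {poly int}) : p.[1] = 0 -> exists q, p = (1 - 'X) * q.
Proof.
move=> /rootP /factor_theorem [q ->]; exists (- q).
by rewrite mulrN -mulNr opprB mulrC.
Qed.

Lemma one_subXn_neq0 (n : nat) : 1 - 'X^(n.+1) != 0 :> {poly int}.
Proof.
apply/eqP => /(congr1 (fun p => p.[0])) /eqP.
by rewrite hornerD hornerN hornerC hornerXn horner0 expr0n subr0.
Qed.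

Lemma one_subX_exp_neq0 (n : nat) : (1 - 'X) ^+ n != 0 :> {poly int}.
Proof. by rewrite expf_neq0 // -['X]expr1 one_subXn_neq0. Qed.

(** [1 - 'X] is prime and does not divide [e], so all its factors pass to [p]. *)
Lemma one_subX_exp_Gauss (i : nat) (p e c : {poly int}) :
  e.[1] != 0 -> p * e = (1 - 'X) ^+ i * c -> exists q, p = (1 - 'X) ^+ i * q.
Proof.
move=> e1; elim: i p => [|i IH] p E; first by exists p; rewrite mul1r.
have /root1_factor[p' Ep] : p.[1] = 0.
  move/(congr1 (horner^~ 1)): E; rewrite exprS -mulrA !hornerM !hornerD.
  rewrite hornerN hornerX hornerC subrr mul0r => /eqP.
  by rewrite mulf_eq0 (negPf e1) orbF => /eqP.
have [q Eq] : exists q, p' = (1 - 'X) ^+ i * q.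
  apply: IH; apply: (mulfI (one_subX_exp_neq0 1)).
  by rewrite expr1 mulrA -Ep E exprS mulrA.
by exists q; rewrite Ep Eq exprS mulrA.
Qed.

Lemma infinitely_many_roots {R : idomainType} (p : {poly R}) (f : nat -> R) :
  injective f -> (forall b, p.[f b] = 0) -> p = 0.
Proof.
move=> f_inj froot; apply/eqP/contraT => p_neq0.
have := max_poly_roots p_neq0 (rs := map f (iota 0 (size p))).
rewrite size_map size_iota ltnn; apply.
  by apply/allP => _ /mapP[b _ ->]; apply/rootP.
by rewrite map_inj_uniq ?iota_uniq.
Qed.

(* Giving [1 - 'X] weight 1, the b-th hypothesis is a linear relation between
   the leading terms at 1 of the [a s]; its coefficients are the powers of
   [(t b).[1]], so infinitely many relations force the leading terms to vanish
   below weight [2 * M]. *)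
Lemma order_at_one (M : nat) (a t u : nat -> {poly int}) :
  injective (fun b => (t b).[1]) -> (forall b, (u b).[1] = 1) ->
  (forall b, exists q, \sum_(s < M)
     a s * ((1 - 'X) ^+ 2 * t b) ^+ (M - s) * u b ^+ s = (1 - 'X) ^+ (2 * M) * q) ->
  forall s, (s < M)%N -> exists q, a s = (1 - 'X) ^+ (2 * s) * q.
Proof.
move=> t_inj u1 Hsum.
(* The order is raised one unit at a time, for all [s] at once. *)
suff Hord i : (i <= 2 * M)%N -> forall s : 'I_M,
    exists q, (1 - 'X) ^+ (2 * (M - s)) * a s = (1 - 'X) ^+ i * q.
  move=> s ltsM; have [q Eq] := Hord _ (leqnn _) (Ordinal ltsM).
  exists q; apply: (mulfI (one_subX_exp_neq0 (2 * (M - s)))).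
  by rewrite Eq mulrA -exprD -mulnDr subnK // ltnW.
elim: i => [|i IH] lei s.
  by exists ((1 - 'X) ^+ (2 * (M - s)) * a s); rewrite mul1r.
have /fin_all_exists[c Ec] := IH (ltnW lei).
pose p : {poly int} := \sum_(s < M) (c s).[1] *: 'X^(M - s).
have p0 : p = 0.
  apply: (infinitely_many_roots p _ t_inj) => b; have [q Eq] := Hsum b.
  have {}Eq : \sum_(s < M) c s * t b ^+ (M - s) * u b ^+ s
      = (1 - 'X) ^+ (2 * M - i) * q.
    apply: (mulfI (one_subX_exp_neq0 i)).
    rewrite mulrA -exprD subnKC ?(ltnW lei) // -Eq mulr_sumr.
    by apply: eq_bigr => j _; rewrite !mulrA -Ec exprMn -exprM; ring.
  move/(congr1 (horner^~ 1)): Eq.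
  rewrite -(subnSK lei) exprS hornerM hornerM hornerD hornerN hornerX hornerC subrr !mul0r.
  move=> <-; rewrite /p !horner_sum; apply: eq_bigr => j _.
  by rewrite !hornerE u1 expr1n mulr1.
have /root1_factor[q Eq] : (c s).[1] = 0.
  (* The exponents [M - s] are distinct, so each [(c s).[1]] is a coefficient of [p]. *)
  have := congr1 (fun p : {poly int} => p`_(M - s)) p0.
  rewrite coef0 /p coef_sum (bigD1 s) //= coefZ coefXn eqxx mulr1 big1 ?addr0 //.
  move=> j ne_js; rewrite coefZ coefXn; case: eqP => [E|]; last by rewrite mulr0.
  by case/eqP: ne_js; apply: val_inj => /=; have := ltn_ord j; have := ltn_ord s; lia.
by exists q; rewrite Ec Eq exprSr mulrA.
Qed.

(** * Integrality, with denominators cleared by q-integers *)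

Definition qint (n : nat) : {poly int} := \sum_(i < n) 'X^i.

Lemma one_subXnE (n : nat) : 1 - 'X^n = (1 - 'X) * qint n.
Proof. by rewrite -[LHS]opprB subrX1 -mulNr opprB. Qed.

Lemma qint_at1 (n : nat) : (qint n).[1] = n%:R.
Proof.
rewrite /qint horner_sum; under eq_bigr do rewrite hornerXn expr1n.
by rewrite sumr_const card_ord.
Qed.

Definition tnum (m s : nat) : {poly int} :=
  \sum_(k < s.+1) (-1) ^+ (s - k) * (bcoef m k)%:~R
    * lucas_coef 'X (m.+1 - s) (s - k) * \prod_(j < s.+1 | j != k) qint (m.+1 - j).

Lemma qint_at1_neq0 (n : nat) : (0 < n)%N -> (qint n).[1] != 0.
Proof. by case: n => // n _; rewrite qint_at1 pnatr_eq0. Qed.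

Lemma tofrac_one_subXn (n : nat) : tofrac (1 - 'X^n) = 1 - yK ^+ n.
Proof. by rewrite tofracB tofrac1 tofracXn. Qed.

Lemma tofrac_sum (n : nat) (f : 'I_n -> {poly int}) :
  tofrac (\sum_(i < n) f i) = \sum_(i < n) tofrac (f i).
Proof. exact: rmorph_sum. Qed.

Lemma one_sub_yK_neq0 (n : nat) : 1 - yK ^+ n.+1 != 0.
Proof. by rewrite -tofrac_one_subXn tofrac_eq0 one_subXn_neq0. Qed.

Lemma natrK_neq0 (n : nat) : n.+1%:R != 0 :> K.
Proof.
rewrite -(rmorph_nat (@tofrac {poly int} : {rmorphism {poly int} -> K})).
by rewrite tofrac_eq0 -polyC_natr polyC_eq0 pnatr_eq0.
Qed.

Lemma one_sub_yKE (n : nat) : 1 - yK ^+ n = (1 - yK) * tofrac (qint n).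
Proof.
by rewrite -tofrac_one_subXn one_subXnE tofracM tofracB tofrac1.
Qed.

Lemma tnumE (m s : nat) : (s <= m)%N ->
  tofrac (tnum m s) = (1 - yK) * tofrac (\prod_(j < s.+1) qint (m.+1 - j)) * tcoef yK m s.
Proof.
move=> lesm; rewrite /tnum /tcoef rmorph_sum mulr_sumr; apply: eq_bigr => k _.
have lek : (k <= m)%N by apply: leq_trans lesm; rewrite -ltnS.
rewrite !rmorphM rmorph_int rmorph_sign rmorph_lucas_coef.
rewrite [in RHS](bigD1 k) //= tofracM.
have := one_sub_yK_neq0 (m - k); rewrite -subSn // one_sub_yKE => q_neq0.
set q := _ * tofrac (qint _) in q_neq0 *.
have cancel_q (F : fieldType) (u a b l p : F) : u != 0 ->
  a * b * l * p = u * p * (a / u * b * l) by move=> u_neq0; field.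
by rewrite [(1 - yK) * _]mulrA; apply: cancel_q.
Qed.

(** As [tnum] carries one extra factor [1 - y], this says that [A_s] vanishes to order [2s - 1]. *)
Lemma tnum_dvd (m s : nat) : (s <= m)%N ->
  exists q, tnum m s = (1 - 'X) ^+ (2 * s) * q.
Proof.
move=> lesm.
pose e s := \prod_(s.+1 <= j < m.+1) qint (m.+1 - j).
pose D := \prod_(j < m.+1) qint (m.+1 - j).
have De k : (k <= m)%N -> \prod_(j < k.+1) qint (m.+1 - j) * e k = D.
  move=> lekm; rewrite /e /D -!(big_mkord xpredT (fun j => qint (m.+1 - j))).
  by rewrite -big_cat_nat.
have e1 k : (e k).[1] != 0.
  rewrite /e horner_prod prodf_seq_neq0; apply/allP => j.
  by rewrite mem_index_iota => /andP[_ ltjm]; rewrite qint_at1_neq0 ?subn_gt0.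
(* The factor [e k] brings all [tnum m k] to the common multiplier [(1 - 'X) * D]. *)
pose a k := (-1) ^+ k * tnum m k * e k.
have [] := order_at_one m.+1 a (fun b => qint b * qint b.+1) (fun b => 'X^b) _ _ _ s.
- move=> b c; rewrite !hornerM !qint_at1 -!natrM => /eqP; rewrite eqr_nat => /eqP.
  nia.
- by move=> b; rewrite hornerXn expr1n.
- move=> b.
  (* Each summand yields [2m + 1] factors [1 - 'X]; the multiplier supplies the last of the
     [2(m+1)]. *)
  exists (D * \sum_(j < b.+1) 'X^((b - j) * m.+1) * (qint j ^+ (2 * m) * qint (j * 2))).
  have -> : (1 - 'X) ^+ (2 * m.+1) * (D * \sum_(j < b.+1)
      'X^((b - j) * m.+1) * (qint j ^+ (2 * m) * qint (j * 2)))
    = (1 - 'X) * D * \sum_(j < b.+1)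
      'X^((b - j) * m.+1) * ((1 - 'X^j) ^+ (2 * m) * (1 - 'X^j ^+ 2)).
    rewrite mulrA !mulr_sumr; apply: eq_bigr => j _.
    rewrite -exprM !one_subXnE exprMn mulnS exprD expr2; ring.
  apply/eqP; rewrite -tofrac_eq; apply/eqP.
  rewrite tofracM [in RHS]tofrac_sum.
  under [in RHS]eq_bigr => j _ do
    rewrite !tofracM !tofracXn !tofracB tofrac1 !tofracXn -/yK.
  rewrite -(tcoef_eval _ _ _ one_sub_yK_neq0) [in RHS]mulr_sumr tofrac_sum.
  apply: eq_bigr => k _.
  have lekm : (k <= m)%N by rewrite -ltnS.
  have -> : (1 - 'X) ^+ 2 * (qint b * qint b.+1) = (1 - 'X^b) * (1 - 'X^(b.+1)).
    by rewrite !one_subXnE; ring.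
  rewrite [in LHS]tofracM [in LHS]tofracM.
  have -> : tofrac (a k) = tofrac ((1 - 'X) * D) * ((-1) ^+ k * tcoef yK m k).
    rewrite /a 2!tofracM tnumE // tofracM -(De k lekm) tofracM tofracB tofrac1.
    by rewrite tofracXn tofracN tofrac1; ring.
  set c := tofrac ((1 - 'X) * D).
  by rewrite !tofracXn tofracM !tofrac_one_subXn -/yK; ring.
- by rewrite ltnS.
move=> q Eq; apply: (one_subX_exp_Gauss (2 * s) _ (e s) ((-1) ^+ s * q)) => //.
by rewrite mulrCA -Eq /a mulrA mulrA -expr2 sqrr_sign mul1r.
Qed.

Theorem theorem3p1 (m : nat) :
  (forall s : nat, (s <= m)%N -> exists p : {poly int}, Pms m s = tofrac p) /\
  \sum_(k < m.+1)
     ((((-1) ^+ k * (bcoef m k)%:~R) / (1 - yK ^+ (m.+1 - k)) : K)%:P *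
      (1 - 'X ^+ (m.+1 - k)) * (1 - ('X * yK%:P) ^+ (m.+1 - k)) * 'X ^+ k)
  =
  \sum_(k < m.+1)
     (((-1) ^+ k * Pms m k * (1 - yK) ^+ (3 * k) /
        \prod_(i < k.+1) (1 - yK ^+ (m.+1 - i)) : K)%:P *
      (1 - 'X) ^+ (m.+1 - k) * (1 - 'X * yK%:P) ^+ (m.+1 - k) * 'X ^+ k
      : {poly K}).
Proof.
have y_neq1 n : (1 - yK) ^+ n != 0.
  by rewrite expf_neq0 // -[yK]expr1 one_sub_yK_neq0.
have PmsE s : (s <= m)%N -> Pms m s =
    (\prod_(j < s.+1) (1 - yK ^+ (m.+1 - j))) / (1 - yK) ^+ (3 * s) * tcoef yK m s.
  move=> lesm; rewrite /Pms; congr (_ * _); apply: eq_bigr => k _; congr (_ * _).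
  by apply: lucas_coefE; rewrite ?natrK_neq0 // -ltnS.
split=> [s lesm|].
  have [q Eq] := tnum_dvd _ _ lesm; exists q.
  have := tnumE _ _ lesm.
  rewrite Eq tofracM tofracXn tofracB tofrac1 -/yK PmsE // => E.
  under eq_bigr do rewrite one_sub_yKE.
  rewrite big_split prodr_const card_ord /= -rmorph_prod.
  apply: (mulfI (y_neq1 (2 * s)%N)); rewrite E.
  have cancel_pow (F : fieldType) (z p c : F) : z ^+ (3 * s) != 0 ->
    z ^+ (2 * s) * (z ^+ s.+1 * p / z ^+ (3 * s) * c) = z * p * c.
    move=> z_neq0; apply: (mulfI z_neq0).
    transitivity (z ^+ (2 * s) * z ^+ s.+1 * p * c); first by field.
    (* The [s + 1] factors [1 - y^N] and the order [2s] of [tnum] together cancel [(1-y)^(3s)],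
       leaving the single [1 - y] of [tnumE]. *)
    rewrite -exprD (_ : (2 * s + s.+1 = (3 * s).+1)%N); last by lia.
    by rewrite exprS; ring.
  by rewrite cancel_pow.
rewrite tcoef_expansion; apply: eq_bigr => s _.
have lesm : (s <= m)%N by rewrite -ltnS.
have cancel_prod (F : fieldType) (e p z c : F) : z != 0 -> p != 0 ->
  e * c = e * (p / z * c) * z / p by move=> z_neq0 p_neq0; field; apply/andP.
have prod_neq0 : \prod_(j < s.+1) (1 - yK ^+ (m.+1 - j)) != 0.
  apply/prodf_neq0 => j _; rewrite subSn ?one_sub_yK_neq0 //.
  by apply: leq_trans lesm; rewrite -ltnS.
(* The factors around [Pms] on the right undo its prefactor, leaving [tcoef]. *)
have E := cancel_prod K ((-1) ^+ s) _ _ (tcoef yK m s) (y_neq1 (3 * s)%N) prod_neq0.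
rewrite -(PmsE _ lesm) in E.
by rewrite [X in X%:P]E.
Qed.
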